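(* Let $\lambda>0$, let $a\ge0$ be an integer, and let $g_a$ be the solution of the Poisson Stein equation for the set $\{a\}$, that is, $g_a(k)=0$ for $k\le0$ and $$g_a(k)=\lambda^{-k}e^{\lambda}(k-1)!\times\begin{cases}\mathcal{P}_\lambda(a)\,\mathcal{P}_\lambda(U_k^c), & k\ge a+1,\\ -\mathcal{P}_\lambda(a)\,\mathcal{P}_\lambda(U_k), & 1\le k\le a.\end{cases}$$ Then, for all integers $k\ge0$, $$\begin{aligned}|\Delta g_a(k)|&\le\frac{1}{\lambda^{3/2}\sqrt{2e}}\bigl(\mathrm{I}[k>a,\,k\ge\lambda]+\mathrm{I}[k<a,\,k<\lambda]\bigr)+\Bigl(\frac{\mathcal{P}_\lambda(a)}{a+1}+\frac{\lambda-k}{\lambda^2}\Bigr)\mathrm{I}[a<k<\lambda]\\ &\quad+\Bigl(\frac{\mathcal{P}_\lambda(a)}{\lambda}+\frac{k-\lambda}{\lambda^2}\Bigr)\mathrm{I}[\lambda\le k<a]+\frac1\lambda\,\mathrm{I}[k=a]\\ &\le\frac{1}{\lambda^{3/2}\sqrt{2e}}+\frac{|\lambda-k|}{\lambda^2}+\frac1\lambda\,\mathrm{I}[k=a].\end{aligned}$$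
   Context: $\mathcal{P}_\lambda$ is the Poisson distribution with mean $\lambda$: $\mathcal{P}_\lambda(j)=e^{-\lambda}\lambda^j/j!$ for integers $j\ge0$, and $\mathcal{P}_\lambda(B)=\sum_{j\in B}\mathcal{P}_\lambda(j)$ for $B\subseteq\{0,1,2,\dots\}$. $U_k:=\{0,\dots,k-1\}$ and $U_k^c$ is its complement in $\{0,1,2,\dots\}$. $\Delta g(k):=g(k+1)-g(k)$, and $\mathrm{I}[\cdot]$ denotes an indicator. The function $g_a$ satisfies $\lambda\Delta g_a(i)-(i-\lambda)g_a(i)=\mathrm{I}[i=a]-\mathcal{P}_\lambda(a)$ for $i\ge0$. *)

(* Defs.v *)
From HB Require Import structures.
From mathcomp Require Import all_boot all_order all_algebra.
From mathcomp Require Import all_classical all_reals all_analysis.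

Set Implicit Arguments.
Unset Strict Implicit.
Unset Printing Implicit Defensive.

Import Order.TTheory GRing.Theory Num.Theory.
Import numFieldNormedType.Exports.

Local Open Scope classical_set_scope.
Local Open Scope ring_scope.

(* [poisson_prob] ignores its [nat] argument; its value lies in [0, 1], so
   [fine] loses nothing. *)
Definition Poisson {R : realType} (lambda : R) (B : set nat) : R :=
  fine (poisson_prob lambda 0%N B).

Definition Delta {R : realType} (g : int -> R) (k : int) : R :=
  g (k + 1) - g k.

(* The solution g_a of the Poisson Stein equation for the set {a},
     lambda * Delta g_a i - (i - lambda) * g_a i
       = I[i = a] - poisson_pmf lambda a    (i >= 0).
   The set U_k = {0, ..., k - 1} is the library's `I_k. *)
Definition stein_sol {R : realType} (lambda : R) (a : nat) (z : int) : R :=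
  if z is Posz n.+1 then
    let k := n.+1 in
    lambda ^- k * expR lambda * (k.-1)`!%:R *
      (if (a.+1 <= k)%N then poisson_pmf lambda a * Poisson lambda (~` `I_k)
       else - (poisson_pmf lambda a * Poisson lambda `I_k))
  else 0.

(* Main.v *)
(* Up to the factor [p a], where [p] is the Poisson mass function and [P] the
   distribution, [g_a] is the upper ratio S k = P (U_k^c) / (k p k) for k > a
   and minus the lower ratio T k = P U_k / (k p k) for k <= a.  The first is
   nonincreasing and the second nondecreasing, which fixes the sign of the
   increments, and lambda S (k + 1) = k S k - 1, lambda T (k + 1) = 1 + k T k
   give their exact size, p a / lambda + (lambda - k) / lambda * p a * S k and
   its mirror image.  Monotonicity also gives p a * S k <= 1 / lambda for k > a
   and p a * T k <= 1 / lambda for k <= a.  What remains is the uniform bound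
   p a <= (2 e lambda)^(-1/2): in logarithmic form the worst lambda is
   a + 1/2, and the value there decreases with a from the case of equality
   a = 0. *)
Require Import Defs.
From HB Require Import structures.
From mathcomp Require Import all_boot all_order all_algebra.
From mathcomp Require Import all_classical all_reals all_analysis.
From mathcomp Require Import ring lra.

Set Implicit Arguments.
Unset Strict Implicit.
Unset Printing Implicit Defensive.

Import Order.TTheory GRing.Theory Num.Theory.
Import numFieldNormedType.Exports.

Local Open Scope classical_set_scope.
Local Open Scope ring_scope.

(** * Poisson tail ratios: recurrences and monotonicity *)

Section stein_solution_monotonicity.
Context {R : realType} (lambda : R).
Hypothesis lambda_gt0 : 0 < lambda.

Local Notation p := (poisson_pmf lambda).
Local Notation P := (Poisson lambda).

Lemma poisson_pmfE k : p k = lambda ^+ k * k`!%:R^-1 * expR (- lambda).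
Proof. by rewrite /poisson_pmf lambda_gt0. Qed.

Lemma poisson_pmf_gt0 k : 0 < p k.
Proof.
by rewrite poisson_pmfE !mulr_gt0 ?exprn_gt0 ?expR_gt0// invr_gt0 ltr0n
  fact_gt0.
Qed.

Lemma poisson_pmfS k : k.+1%:R * p k.+1 = lambda * p k.
Proof.
rewrite !poisson_pmfE exprS factS natrM invfM.
have : k.+1%:R != 0 :> R by rewrite pnatr_eq0.
have : k`!%:R != 0 :> R by rewrite pnatr_eq0 -lt0n fact_gt0.
by move=> h1 h2; field; rewrite h1 nat1r h2.
Qed.

Lemma Poisson_I0 : P `I_0 = 0.
Proof. by rewrite /Poisson II0 measure0. Qed.

Lemma Poisson_ge0 B : 0 <= P B.
Proof. by rewrite /Poisson fine_ge0. Qed.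

Lemma Poisson_setC B : P (~` B) = 1 - P B.
Proof.
by rewrite /Poisson probability_setC// fineB// fin_num_measure.
Qed.

Lemma Poisson_IS k : P `I_k.+1 = P `I_k + p k.
Proof.
rewrite /Poisson IIS measureU//.
  rewrite fineD ?fin_num_measure//; congr (_ + _).
  by rewrite /= /poisson_prob lambda_gt0 esum_set1 ?lee_fin ?poisson_pmf_ge0.
by apply/seteqP; split => x //= [/[swap] ->]; rewrite ltnn.
Qed.

Lemma Poisson_le1 B : P B <= 1.
Proof. by rewrite -subr_ge0 -Poisson_setC Poisson_ge0. Qed.

(** These probabilities are [expR (- lambda)] times the partial sums of the exponential series at
    [lambda]. *)
Lemma Poisson_I_cvg1 : P `I_n @[n --> \oo] --> (1 : R).
Proof.
have -> : (fun n => P `I_n) =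
    (fun n => expR (- lambda) * series (exp_coeff lambda) n).
  apply/funext; elim=> [|n ih].
    by rewrite Poisson_I0 /series/= big_nil mulr0.
  rewrite Poisson_IS ih /series/= big_nat_recr//= mulrDr; congr (_ + _).
  by rewrite poisson_pmfE /exp_coeff mulrC.
have -> : 1 = expR (- lambda) * expR lambda :> R.
  by rewrite expRN mulVf// gt_eqF// expR_gt0.
exact: cvgM (cvg_cst _) (is_cvg_series_exp_coeff lambda).
Qed.

(** Passing from [k] to [k + 1] adds [lambda * p k = (k + 1) * p (k + 1)] to the left side, and the
    same amount plus the probability of U_(k+1) to the right side. *)
Lemma Poisson_I_step k : lambda * P `I_k <= k%:R * P `I_k.+1.
Proof.
elim: k => [|k ih]; first by rewrite Poisson_I0 mulr0 mul0r.
have := Poisson_ge0 `I_k.+1; have := poisson_pmfS k.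
rewrite (Poisson_IS k.+1) -natr1; move: ih; rewrite Poisson_IS.
have := poisson_pmf_ge0 lambda k; nra.
Qed.

(* Termwise, [k * p (j + 1) <= (j + 1) * p (j + 1) = lambda * p j] for [k <= j],
   so the inequality holds for the sums over [k <= j < n]; let [n] go to
   infinity. *)
Lemma Poisson_setCI_step k :
  k%:R * P (~` `I_k.+1) <= lambda * P (~` `I_k).
Proof.
have fin n : k%:R * (P `I_(n + k).+1 - P `I_k.+1)
    <= lambda * (P `I_(n + k) - P `I_k).
  elim: n => [|n ih]; first by rewrite !subrr !mulr0.
  rewrite addSn (Poisson_IS (n + k).+1) (Poisson_IS (n + k)).
  move: ih; rewrite (Poisson_IS (n + k)).
  have := poisson_pmfS (n + k); have := poisson_pmf_gt0 (n + k).+1.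
  by rewrite -natr1 natrD; have : 0 <= n%:R :> R by []; nra.
rewrite !Poisson_setC.
have cvg : k%:R * (P `I_(n + k.+1) - P `I_k.+1) @[n --> \oo]
    --> k%:R * (1 - P `I_k.+1).
  apply: cvgM; first exact: cvg_cst.
  apply: cvgB; last exact: cvg_cst.
  by rewrite (cvg_shiftn k.+1 (fun n => P `I_n)); exact: Poisson_I_cvg1.
rewrite -(cvg_lim _ cvg)//; apply: limr_le.
  by apply/cvg_ex; eexists; exact: cvg.
(* Only the left side is passed to the limit; on the right, bounding a probability by 1 is
   enough. *)
near=> n; rewrite addnS (le_trans (fin n))// ler_pM2l//.
by rewrite lerB// Poisson_le1.
Unshelve. all: by end_near. Qed.

(** Both ratios are 0 at [k = 0], where the denominator vanishes. For [lower_ratio] this agrees with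
    g_a(0) = 0, while [upper_ratio] is monotone only from index 1 on. *)
Definition lower_ratio k : R := P `I_k / (k%:R * p k).
Definition upper_ratio k : R := P (~` `I_k) / (k%:R * p k).

Lemma lower_ratio_ge0 k : 0 <= lower_ratio k.
Proof. by rewrite divr_ge0 ?Poisson_ge0// mulr_ge0// poisson_pmf_ge0. Qed.

Lemma upper_ratio_ge0 k : 0 <= upper_ratio k.
Proof. by rewrite divr_ge0 ?Poisson_ge0// mulr_ge0// poisson_pmf_ge0. Qed.

Lemma lower_ratioS k : lambda * lower_ratio k.+1 = 1 + k%:R * lower_ratio k.
Proof.
have pk := lt0r_neq0 (poisson_pmf_gt0 k); have l0 := lt0r_neq0 lambda_gt0.
rewrite /lower_ratio poisson_pmfS Poisson_IS; case: k pk => [|k] pk.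
  by rewrite Poisson_I0 !mul0r; field; rewrite pk l0.
by field; rewrite pk l0 nat1r pnatr_eq0.
Qed.

Lemma upper_ratioS k :
  lambda * upper_ratio k.+2 = k.+1%:R * upper_ratio k.+1 - 1.
Proof.
have pk := lt0r_neq0 (poisson_pmf_gt0 k.+1); have l0 := lt0r_neq0 lambda_gt0.
rewrite /upper_ratio poisson_pmfS !Poisson_setC (Poisson_IS k.+1).
by field; rewrite pk l0 nat1r pnatr_eq0.
Qed.

(** The denominators are [k * p k] and, by [poisson_pmfS], [lambda * p k]; cross-multiplication
    leaves [Poisson_I_step]. *)
Lemma lower_ratio_le_succ k : lower_ratio k <= lower_ratio k.+1.
Proof.
case: k => [|k].
  by rewrite {1}/lower_ratio mul0r invr0 mulr0 lower_ratio_ge0.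
have pk := poisson_pmf_gt0 k.+1.
rewrite /lower_ratio (poisson_pmfS k.+1) ler_pdivrMr ?mulr_gt0//.
rewrite mulrAC ler_pdivlMr ?mulr_gt0//.
have := ler_wpM2l (ltW pk) (Poisson_I_step k.+1).
by move: (k.+1%:R : R) => x; lra.
Qed.

Lemma upper_ratio_succ_le k : upper_ratio k.+2 <= upper_ratio k.+1.
Proof.
have pk := poisson_pmf_gt0 k.+1.
rewrite /upper_ratio (poisson_pmfS k.+1) ler_pdivrMr ?mulr_gt0//.
rewrite mulrAC ler_pdivlMr ?mulr_gt0//.
have := ler_wpM2l (ltW pk) (Poisson_setCI_step k.+1).
by move: (k.+1%:R : R) => x; lra.
Qed.

Lemma lower_ratio_le k m : (k <= m)%N -> lower_ratio k <= lower_ratio m.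
Proof.
move=> /subnK <-; elim: (m - k)%N => // n ih.
by rewrite addSn (le_trans ih)// lower_ratio_le_succ.
Qed.

Lemma upper_ratio_le k m : (0 < k <= m)%N -> upper_ratio m <= upper_ratio k.
Proof.
case: k => // k /andP[_ /subnK <-]; elim: (m - k.+1)%N => // n ih.
by rewrite addSn addnS (le_trans (upper_ratio_succ_le _))// -addnS.
Qed.

(** For [k > 0] the prefactor of [stein_sol] is the inverse of [k * p k]; [k = 0] falls in the
    second branch, where [lower_ratio] is 0. *)
Lemma stein_solE a k : stein_sol lambda a k%:Z =
  if (a < k)%N then p a * upper_ratio k else - (p a * lower_ratio k).
Proof.
case: k => [|k]; first by rewrite /lower_ratio mul0r invr0 !mulr0 oppr0.
have cst : lambda ^- k.+1 * expR lambda * k`!%:R = (k.+1%:R * p k.+1)^-1.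
  rewrite poisson_pmfE factS natrM expRN.
  have : k.+1%:R != 0 :> R by rewrite pnatr_eq0.
  have : k`!%:R != 0 :> R by rewrite pnatr_eq0 -lt0n fact_gt0.
  move=> h1 h2; field.
  rewrite nat1r h1 h2 (lt0r_neq0 (expR_gt0 _)) /=.
  by rewrite expf_neq0// (lt0r_neq0 lambda_gt0).
rewrite /= cst /upper_ratio /lower_ratio.
case: ifP => _; first by rewrite mulrC mulrA.
by rewrite mulrC mulNr mulrA.
Qed.

(** Equality would hold with [lower_ratio a.+1], whose denominator is [lambda * p a]. The bound is
    not weakened to 1, so that it can be added to [pmf_upper_ratio] with total exactly 1. *)
Lemma pmf_lower_ratio_le a : lambda * (p a * lower_ratio a) <= P `I_a.+1.
Proof.
have pa := poisson_pmf_gt0 a.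
have <- : lambda * (p a * lower_ratio a.+1) = P `I_a.+1.
  by rewrite /lower_ratio poisson_pmfS; field; rewrite !lt0r_neq0.
by rewrite !ler_pM2l// lower_ratio_le_succ.
Qed.

Lemma pmf_upper_ratio a : lambda * (p a * upper_ratio a.+1) = P (~` `I_a.+1).
Proof.
have pa := poisson_pmf_gt0 a.
rewrite /upper_ratio poisson_pmfS; field.
by rewrite !lt0r_neq0.
Qed.

End stein_solution_monotonicity.

(** * Uniform bound on the Poisson mass function *)

Section poisson_pmf_bound.
Context {R : realType}.

(* The difference of the two sides vanishes at [u = 0] and has derivative
   [ln (1 - u ^+ 2) <= 0]. *)
Lemma ln_midpoint_bound (u : R) : 0 <= u < 1 ->
  (1 + u) * ln (1 + u) - (1 - u) * ln (1 - u) <= 2 * u.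
Proof.
move=> /andP[u0 u1].
pose h (t : R) := (1 + t) * ln (1 + t) - (1 - t) * ln (1 - t) - 2 * t.
have dh (t : R) : -1 < t < 1 -> is_derive t 1 h (ln (1 + t) + ln (1 - t)).
  move=> /andP[t0 t1].
  have p1 : 0 < 1 + t by lra.
  have p2 : 0 < 1 - t by lra.
  have d1 := is_derive1_ln p1; have d2 := is_derive1_ln p2.
  have dp : is_derive t 1 ((cst 1 : R -> R) + id) (0 + 1).
    exact: is_deriveD.
  have dm : is_derive t 1 ((cst 1 : R -> R) - id) (0 - 1).
    exact: is_deriveB.
  have d3 := is_derive1_comp (f := @ln R) (g := (cst 1 : R -> R) + id) d1 dp.
  have d4 := is_derive1_comp (f := @ln R) (g := (cst 1 : R -> R) - id) d2 dm.
  have d5 : is_derive t 1 (cst 2 * id : R -> R) (2 *: 1 + t *: 0).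
    exact: is_deriveM.
  have D := is_deriveB (is_deriveB (is_deriveM dp d3) (is_deriveM dm d4)) d5.
  apply: (is_derive_eq D); rewrite /= !fctE /=.
  rewrite /GRing.scale/=; field.
  by rewrite !lt0r_neq0.
have [||c] := @MVT_segment R h (fun t => ln (1 + t) + ln (1 - t)) 0 u u0.
- by move=> x; rewrite in_itv/= => /andP[x0 xu]; apply: dh; lra.
- apply: derivable_within_continuous => x; rewrite in_itv/= => /andP[x0 xu].
  by apply: ex_derive; apply: dh; lra.
rewrite in_itv/= => /andP[c0 cu].
rewrite /h !(addr0, subr0, mulr0, ln1).
rewrite -lnM ?posrE; [|lra..].
have : ln ((1 + c) * (1 - c)) <= 0 by apply: ln_le0; nra.
nra.
Qed.

(** The left side is the maximum over [lambda] of the logarithm of [sqrt lambda * p n], attained at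
    [lambda = n + 1/2]. It is nonincreasing in [n], and [n = 0] gives equality. *)
Lemma half_shift_entropy_bound (n : nat) :
  (n%:R + 2^-1) * ln (n%:R + 2^-1) - (n%:R + 2^-1) - ln n`!%:R
    <= - (2^-1 * ln 2 + 2^-1) :> R.
Proof.
elim: n => [|n ih].
  by rewrite add0r fact0 ln1 lnV ?posrE//; lra.
set m : R := n.+1%:R in ih *.
have m1 : 1 <= m by rewrite ler1n.
have m0 : 0 < m by lra.
have nE : n%:R = m - 1 :> R by rewrite /m -natr1 addrK.
rewrite factS natrM lnM ?posrE ?ltr0n ?fact_gt0//.
(* With this [u], the consecutive half-integers [m + 1/2] and [m - 1/2] are [m * (1 + u)] and
   [m * (1 - u)]; the terms in [ln m] then cancel and [ln_midpoint_bound] controls the rest. *)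
pose u := (2 * m)^-1.
have mu : m * u = 2^-1 by rewrite /u; field; lra.
have u0 : 0 < u by rewrite invr_gt0; lra.
have u1 : u < 1 by nra.
have hp : m + 2^-1 = m * (1 + u) by rewrite mulrDr mulr1 mu.
have hm : n%:R + 2^-1 = m * (1 - u) by rewrite mulrBr mulr1 mu nE; lra.
move: ih; rewrite hp hm !lnM ?posrE; [|lra..].
have := @ln_midpoint_bound u; rewrite ltW ?u1//= => /(_ erefl).
rewrite -/m.
move: (ln m) (ln (1 + u)) (ln (1 - u)) => Lm Lp Lq mid ih.
have : m * ((1 + u) * Lp - (1 - u) * Lq) <= m * (2 * u) by rewrite ler_pM2l.
have -> : m * (2 * u) = 1 by rewrite mulrCA mu; lra.
have -> : m * (1 + u) = m + 2^-1 by rewrite mulrDr mulr1 mu.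
have e : m * (1 - u) = m - 2^-1 by rewrite mulrBr mulr1 mu.
rewrite e in ih; rewrite mulrBr !mulrA e mulrDr mulr1 mu.
lra.
Qed.

Lemma poisson_pmf_le_sqrt (lambda : R) (a : nat) : 0 < lambda ->
  poisson_pmf lambda a <= (Num.sqrt lambda * Num.sqrt (2 * expR 1))^-1.
Proof.
move=> l0.
have s0 : 0 < 2 * expR 1 :> R by rewrite mulr_gt0// expR_gt0.
have pa := poisson_pmf_gt0 l0 a.
rewrite -sqrtrM ?(ltW l0)// -ler_ln ?posrE ?invr_gt0 ?sqrtr_gt0 ?mulr_gt0//.
rewrite lnV ?posrE ?sqrtr_gt0 ?mulr_gt0// -powR12_sqrt ?ln_powR; last first.
  by rewrite ltW// mulr_gt0.
rewrite /poisson_pmf l0 !lnM ?posrE ?mulr_gt0 ?exprn_gt0 ?expR_gt0 ?invr_gt0//;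
  [|by rewrite ltr0n fact_gt0..].
rewrite !expRK lnV ?posrE ?ltr0n ?fact_gt0// lnXn// -(mulr_natl (ln lambda)).
have := half_shift_entropy_bound a; set x : R := a%:R + 2^-1.
have x0 : 0 < x by rewrite /x ltr_wpDl.
(* The left side is maximal at [lambda = x]: this is [ln t <= t - 1] at [t = lambda / x], multiplied
   by [x]. *)
have : x * ln lambda - lambda <= x * ln x - x.
  have : ln (lambda / x) <= lambda / x - 1.
    have := @le_ln1Dx R (lambda / x - 1); rewrite (addrC 1) subrK; apply.
    by rewrite ltrBrDr addNr divr_gt0.
  rewrite ln_div ?posrE// => h.
  have : x * (ln lambda - ln x) <= x * (lambda / x - 1) by rewrite ler_pM2l.
  by rewrite !mulrBr mulrCA divff ?lt0r_neq0// !mulr1; lra.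
have -> : a%:R = x - 2^-1 by rewrite addrK.
lra.
Qed.

End poisson_pmf_bound.

(** * Increments of the Stein solution *)

Section stein_solution_increments.
Context {R : realType} (lambda : R) (a : nat).
Hypothesis lambda_gt0 : 0 < lambda.

Local Notation p := (poisson_pmf lambda).
Local Notation g := (stein_sol lambda a).
Local Notation B := (1 / (lambda `^ (3 / 2) * Num.sqrt (2 * expR 1))).

Lemma poisson_pmf_div_le i : p i / lambda <= B.
Proof.
have -> : lambda `^ (3 / 2) = lambda * Num.sqrt lambda.
  rewrite (_ : 3 / 2 = 1 + 2^-1); last by lra.
  rewrite powRD; last by apply/implyP => _; rewrite lt0r_neq0.
  by rewrite powRr1 ?powR12_sqrt ?ltW.
rewrite div1r -mulrA invfM mulrC ler_pM2l ?invr_gt0//.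
exact: poisson_pmf_le_sqrt.
Qed.

(** This is the previous bound one index higher; it absorbs the mass term for [a < k < lambda] in
    the second inequality. *)
Lemma poisson_pmf_div_succ_le i : p i / i.+1%:R <= B.
Proof.
suff -> : p i / i.+1%:R = p i.+1 / lambda by exact: poisson_pmf_div_le.
apply/eqP; rewrite eqr_div ?lt0r_neq0// mulrC -poisson_pmfS//.
by rewrite mulrC.
Qed.

Lemma Delta_stein_sol_above k : (a < k)%N ->
  `|Delta g k%:Z| = p a / lambda
    + (lambda - k%:R) / lambda * (p a * upper_ratio lambda k).
Proof.
case: k => // k ak; have pa := poisson_pmf_gt0 lambda_gt0 a.
rewrite /Delta -PoszD addn1 !stein_solE// ak ltnS (ltnW ak) -mulrBr normrM.
rewrite gtr0_norm// ler0_norm ?subr_le0 ?upper_ratio_succ_le//.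
have -> : upper_ratio lambda k.+2
    = (k.+1%:R * upper_ratio lambda k.+1 - 1) / lambda.
  by rewrite -upper_ratioS// mulrAC divff ?mul1r// lt0r_neq0.
by field; rewrite lt0r_neq0.
Qed.

Lemma Delta_stein_sol_below k : (k < a)%N ->
  `|Delta g k%:Z| = p a / lambda
    + (k%:R - lambda) / lambda * (p a * lower_ratio lambda k).
Proof.
move=> ka; have pa := poisson_pmf_gt0 lambda_gt0 a.
rewrite /Delta -PoszD addn1 !stein_solE// ltnNge ka ltnNge (ltnW ka) /=.
rewrite -opprD normrN -mulrBr normrM.
rewrite gtr0_norm// ger0_norm ?subr_ge0 ?lower_ratio_le_succ//.
have -> : lower_ratio lambda k.+1 = (1 + k%:R * lower_ratio lambda k) / lambda.
  by rewrite -lower_ratioS// mulrAC divff ?mul1r// lt0r_neq0.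
by field; rewrite lt0r_neq0.
Qed.

(** Here the two branches of g_a meet and their sizes add up; multiplied by [lambda], they are at
    most the probabilities of the complement of U_(a+1) and of U_(a+1). *)
Lemma Delta_stein_sol_at : `|Delta g a%:Z| <= 1 / lambda.
Proof.
have pa := poisson_pmf_gt0 lambda_gt0 a.
rewrite /Delta -PoszD addn1 !stein_solE// ltnn ltnSn opprK.
rewrite ger0_norm; last first.
  rewrite addr_ge0// mulr_ge0// ?(ltW pa)//.
    exact: upper_ratio_ge0.
  exact: lower_ratio_ge0.
rewrite ler_pdivlMr// mulrC mulrDr pmf_upper_ratio// Poisson_setC//.
by have := pmf_lower_ratio_le lambda_gt0 a; lra.
Qed.

(** By monotonicity the worst case is [k = a + 1], where [lambda] times the left side is a
    probability. *)
Lemma pmf_upper_ratio_le k :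
  (a < k)%N -> p a * upper_ratio lambda k <= lambda^-1.
Proof.
move=> ak; have pa := poisson_pmf_gt0 lambda_gt0 a.
rewrite -[leRHS]div1r ler_pdivlMr// mulrC.
rewrite (le_trans _ (Poisson_le1 lambda (~` `I_a.+1)))// -pmf_upper_ratio//.
by rewrite !ler_pM2l// upper_ratio_le.
Qed.

Lemma pmf_lower_ratio_le_inv k :
  (k <= a)%N -> p a * lower_ratio lambda k <= lambda^-1.
Proof.
move=> ka; have pa := poisson_pmf_gt0 lambda_gt0 a.
rewrite -[leRHS]div1r ler_pdivlMr// mulrC.
rewrite (le_trans _ (Poisson_le1 lambda `I_a.+1))//.
rewrite (le_trans _ (pmf_lower_ratio_le lambda_gt0 a))//.
by rewrite !ler_pM2l// lower_ratio_le.
Qed.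

End stein_solution_increments.

(** * Case analysis on the position of [k] relative to [a] and [lambda] *)

Theorem lemma3p3 (R : realType) (lambda : R) (a : nat) :
  0 < lambda ->
  forall k : nat,
  `|Delta (stein_sol lambda a) k%:Z|
    <= 1 / (lambda `^ (3 / 2) * Num.sqrt (2 * expR 1))
         * (((a < k)%N && (lambda <= k%:R))%:R
            + ((k < a)%N && (k%:R < lambda))%:R)
       + (poisson_pmf lambda a / a.+1%:R + (lambda - k%:R) / lambda ^+ 2)
         * ((a < k)%N && (k%:R < lambda))%:R
       + (poisson_pmf lambda a / lambda + (k%:R - lambda) / lambda ^+ 2)
         * ((lambda <= k%:R) && (k < a)%N)%:R
       + 1 / lambda * (k == a)%:R
    <= 1 / (lambda `^ (3 / 2) * Num.sqrt (2 * expR 1))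
       + `|lambda - k%:R| / lambda ^+ 2
       + 1 / lambda * (k == a)%:R.
Proof.
move=> l0 k.
have pa := poisson_pmf_gt0 l0 a.
have Bl := poisson_pmf_div_le l0 a; have Bs := poisson_pmf_div_succ_le l0 a.
set B := 1 / _ in Bl Bs *.
have B0 : 0 <= B by apply: le_trans Bl; rewrite divr_ge0 ?ltW.
have n0 : 0 <= `|lambda - k%:R| / lambda ^+ 2.
  by rewrite divr_ge0// exprn_ge0// ltW.
have sq x : x / lambda ^+ 2 = x / lambda * lambda^-1.
  by rewrite expr2 invfM mulrA.
have [ak|ka|ak] := ltngtP a k; rewrite ?andbT ?andbF /=.
- rewrite (Delta_stein_sol_above l0 ak).
  have [kl|lk] := leP lambda k%:R;
    rewrite ?(mulr0, mulr1, addr0, add0r); apply/andP; split.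
  (* For [k >= lambda] the term in [lambda - k] is nonpositive and is dropped. *)
  + apply: le_trans Bl; rewrite gerDl mulr_le0_ge0//.
      by rewrite mulr_le0_ge0 ?subr_le0// invr_ge0 ltW.
    by rewrite mulr_ge0 ?upper_ratio_ge0// ltW.
  + by rewrite lerDl.
  (* Here [a + 1 <= k < lambda], so [p a / lambda] is at most [p a / (a + 1)]. *)
  + apply: lerD.
      rewrite ler_pM2l// lef_pV2 ?posrE// (le_trans _ (ltW lk))//.
      by rewrite ler_nat.
    rewrite sq ler_wpM2l ?pmf_upper_ratio_le//.
    by rewrite divr_ge0 ?subr_ge0 ?ltW.
  + by apply: lerD => //; rewrite ger0_norm// subr_ge0 ltW.
- rewrite (Delta_stein_sol_below l0 ka).
  have [kl|lk] := leP lambda k%:R;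
    rewrite ?(mulr0, mulr1, addr0, add0r); apply/andP; split.
  + apply: lerD => //; rewrite sq ler_wpM2l//.
      by rewrite divr_ge0 ?subr_ge0 ?(ltW l0).
    by rewrite pmf_lower_ratio_le_inv// ltnW.
  + by apply: lerD => //; rewrite distrC ger0_norm// subr_ge0.
  + apply: le_trans Bl; rewrite gerDl mulr_le0_ge0//.
      by rewrite mulr_le0_ge0 ?subr_le0 ?invr_ge0 ?ltW.
    by rewrite mulr_ge0 ?lower_ratio_ge0// ltW.
  + by rewrite lerDl.
- subst k; rewrite ?(mulr0, mulr1, addr0, add0r); apply/andP; split.
    exact: (Delta_stein_sol_at a l0).
  by rewrite lerDr addr_ge0.
Qed.
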